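(* Consider the system $$\dot x=Ax+B_1w+B_2u,\qquad z=C_1x,$$ with $A\in\mathbb{R}^{n\times n}$, $B_1\in\mathbb{R}^{n\times 1}$, $B_2\in\mathbb{R}^{n\times r}$, $C_1\in\mathbb{R}^{1\times n}$, where $C_1B_2$ is nonsingular (so $r=1$), $R=C_1B_1+B_1^TC_1^T>0$, and $(A,B_1,C_1,0)$ is a minimal realization of the SISO transfer function $G(s)=C_1(sI-A)^{-1}B_1$. Let $\epsilon>0$ be given, and let $U$, $A_f$, $B_f$, $\tilde B_1$, $A_{22}$, $B_{f2}$, $B_{22}$ be obtained from the real Schur decomposition, described in the context, of $A+\epsilon I-B_2(C_1B_2)^{-1}C_1(A+\epsilon I)$. Suppose there exist matrices $T\ge 0$ and $S\ge 0$ such that $$-A_{22}T-TA_{22}^T+B_{f2}RB_{f2}^T=0,$$ $$-A_{22}S-SA_{22}^T+B_{22}R^{-1}B_{22}^T=0,$$ $$T-S>0.$$ Then there exists a static state-feedback matrix $K$ such that, with $u=Kx$, the closed-loop system $$\dot x=(A+B_2K)x+B_1w,\qquad z=C_1x$$ is negative imaginary with degree of stability $\epsilon$. Furthermore, a corresponding state feedback controller matrix is $$K=(C_1B_2)^{-1}\bigl(B_1^TP-C_1A-\epsilon C_1-R(B_2^TC_1^T)^{-1}B_2^TP\bigr),$$ where $P=UP_fU^T$ and $P_f=\begin{bmatrix}0&0\\0&(T-S)^{-1}\end{bmatrix}\ge 0$ (partitioned conformally with $A_f$). Also, $P_f$ satisfies the algebraic Riccati equation $$P_fA_f+A_f^TP_f-P_fB_fRB_f^TP_f+P_f\tilde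 B_1R^{-1}\tilde B_1^TP_f=0.$$
   Context: Schur decomposition. $U\in\mathbb{R}^{n\times n}$ is an orthogonal matrix, obtained by the real Schur transformation, such that $$A_f=U^T\bigl(A+\epsilon I-B_2(C_1B_2)^{-1}C_1A-\epsilon B_2(C_1B_2)^{-1}C_1\bigr)U=\begin{bmatrix}A_{11}&A_{12}\\0&A_{22}\end{bmatrix},$$ where all eigenvalues of $A_{11}$ lie in the closed left half plane and $A_{22}$ is anti-stable (all its eigenvalues lie in the open right half plane). Conformally with this partition, $$B_f=U^T\bigl(B_2(C_1B_2)^{-1}-B_1R^{-1}\bigr)=\begin{bmatrix} B_{f1} \\ B_{f2} \end{bmatrix},\qquad \tilde B_1=U^TB_1=\begin{bmatrix} B_{11} \\ B_{22} \end{bmatrix}.$$ Matrix inequalities $\ge 0$, $>0$ mean symmetric (Hermitian) positive semidefinite, positive definite. The closed-loop system has degree of stability $\epsilon$ if all eigenvalues of $A+B_2K$ have real part at most $-\epsilon$. The closed-loop system is negative imaginary if its transfer function $C_1(sI-A-B_2K)^{-1}B_1$ from $w$ to $z$ is negative imaginary. Definition (negative imaginary, NI). A square real rational transfer function matrix $G(s)$ is negative imaginary (NI) if: (1) $G(s)$ has no pole in $\mathrm{Re}[s]>0$; (2) for all $\omega\ge 0$ such that $j\omega$ is not a pole of $G(s)$, $j(G(j\omega)-G(j\omega)^* )\ge 0$; (3) if $s=j\omega_0$ with $\omega_0>0$ is a pole of $G(s)$, then it is a simple pole and the matrix $K_0=\lim_{s\to j\omega_0}(s-j\omega_0)\,jG(s)$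 is Hermitian positive semidefinite; (4) if $s=0$ is a pole of $G(s)$, then it is either a simple pole or a double pole, and if it is a double pole then $\lim_{s\to 0}s^2G(s)\ge 0$. Here $j=\sqrt{-1}$ and $^*$ is the complex conjugate transpose. *)

(* Defs.v *)
From HB Require Import structures.
From mathcomp Require Import all_boot all_order all_algebra.
From mathcomp Require Import complex.
From mathcomp Require Import boolp classical_sets reals topology normedtype.

Set Implicit Arguments.
Unset Strict Implicit.
Unset Printing Implicit Defensive.

Import Order.TTheory GRing.Theory Num.Theory.
Import numFieldNormedType.Exports.

Local Open Scope ring_scope.
Local Open Scope complex_scope.
Local Open Scope sesquilinear_scope.
Local Open Scope classical_set_scope.

Definition psdmx (R : realType) n (M : 'M[R]_n) : Prop :=
  M^T = M /\ forall x : 'cV[R]_n, 0 <= (x^T *m M *m x) 0 0.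

Definition pdmx (R : realType) n (M : 'M[R]_n) : Prop :=
  M^T = M /\ forall x : 'cV[R]_n, x != 0 -> 0 < (x^T *m M *m x) 0 0.

(* The order of R[i] is partial: 0 <= z entails that z is real. *)
Definition hpsdmx (R : realType) n (M : 'M[R[i]]_n) : Prop :=
  M ^t* = M /\ forall x : 'cV[R[i]]_n, 0 <= (x ^t* *m M *m x) 0 0.

Definition ceigenvalue (R : realType) n (M : 'M[R]_n) (z : R[i]) : Prop :=
  eigenvalue (map_mx (real_complex R) M) z.

(* No strictness: the spectrum may touch the line Re z = - eps. *)
Definition degree_of_stability (R : realType) n (M : 'M[R]_n) (eps : R) : Prop :=
  forall z : R[i], ceigenvalue M z -> complex.Re z <= - eps.

Definition antistable (R : realType) n (M : 'M[R]_n) : Prop :=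
  forall z : R[i], ceigenvalue M z -> 0 < complex.Re z.

Definition spectrum_closed_lhp (R : realType) n (M : 'M[R]_n) : Prop :=
  forall z : R[i], ceigenvalue M z -> complex.Re z <= 0.

Section RationalFunctions.
Variable R : realType.

Definition ratfun := {fraction {poly R}}.

(* The representative chosen by repr need not be reduced, so common factors are
   divided out; ratnum and ratden are coprime and unique up to a common nonzero
   constant, on which neither values nor pole orders depend. *)
Definition ratnum (g : ratfun) : {poly R} :=
  let r : {ratio {poly R}} := repr g in \n_r %/ gcdp \n_r \d_r.

Definition ratden (g : ratfun) : {poly R} :=
  let r : {ratio {poly R}} := repr g in \d_r %/ gcdp \n_r \d_r.

(* Meaningful only when z is not a pole of g. *)
Definition rateval (g : ratfun) (z : R[i]) : R[i] :=
  (map_poly (real_complex R) (ratnum g)).[z] /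
  (map_poly (real_complex R) (ratden g)).[z].

Definition rat_pole_order (g : ratfun) (z : R[i]) : nat :=
  mup z (map_poly (real_complex R) (ratden g)).

Definition mxeval m p (G : 'M[ratfun]_(m, p)) (z : R[i]) : 'M[R[i]]_(m, p) :=
  \matrix_(i, k) rateval (G i k) z.

(* The order of z as a pole of a matrix is the largest order of z as a pole of
   an entry; it is 0 when z is not a pole. *)
Definition pole_order m p (G : 'M[ratfun]_(m, p)) (z : R[i]) : nat :=
  \max_(i < m) \max_(k < p) rat_pole_order (G i k) z.

Definition is_pole m p (G : 'M[ratfun]_(m, p)) (z : R[i]) : Prop :=
  (0 < pole_order G z)%N.

(* F s tends to L entrywise as s tends to z, s != z; the topology of the complex
   plane is carried by the alias R[i]^o. *)
Definition mxcvg m p (F : R[i] -> 'M[R[i]]_(m, p)) (z : R[i])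
    (L : 'M[R[i]]_(m, p)) : Prop :=
  forall i k,
    (fun s : R[i]^o => F s i k : R[i]^o) @ (z : R[i]^o)^' --> (L i k : R[i]^o).

Record negative_imaginary m (G : 'M[ratfun]_m) : Prop := NegativeImaginary {
  ni_no_rhp_pole : forall z : R[i], 0 < complex.Re z -> ~ is_pole G z;
  ni_axis : forall w : R, 0 <= w -> ~ is_pole G w*i ->
    hpsdmx ('i%C *: (mxeval G w*i - (mxeval G w*i) ^t*));
  ni_axis_pole : forall w : R, 0 < w -> is_pole G w*i ->
    pole_order G w*i = 1%N /\
    exists2 K0 : 'M[R[i]]_m,
      mxcvg (fun s => (s - w*i) *: ('i%C *: mxeval G s)) w*i K0
      & hpsdmx K0;
  ni_origin_pole : is_pole G 0 ->
    pole_order G 0 = 1%N \/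
    pole_order G 0 = 2%N /\
    exists2 L : 'M[R[i]]_m,
      mxcvg (fun s => s ^+ 2 *: mxeval G s) 0 L
      & hpsdmx L
}.

(* C (s I - A)^-1 B + D, with s the indeterminate of R(s). *)
Definition transfer_function n m p (A : 'M[R]_n) (B : 'M[R]_(n, m))
    (C : 'M[R]_(p, n)) (D : 'M[R]_(p, m)) : 'M[ratfun]_(p, m) :=
  let toF k l (M : 'M[R]_(k, l)) : 'M[ratfun]_(k, l) :=
    map_mx (fun a : R => tofrac a%:P) M in
  toF _ _ C *m invmx ((tofrac 'X)%:M - toF _ _ A) *m toF _ _ B + toF _ _ D.

Definition minimal_realization n m p (A : 'M[R]_n) (B : 'M[R]_(n, m))
    (C : 'M[R]_(p, n)) (D : 'M[R]_(p, m)) (G : 'M[ratfun]_(p, m)) : Prop :=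
  transfer_function A B C D = G /\
  forall n' (A' : 'M[R]_n') (B' : 'M[R]_(n', m))
      (C' : 'M[R]_(p, n')) (D' : 'M[R]_(p, m)),
    transfer_function A' B' C' D' = G -> (n <= n')%N.

End RationalFunctions.

(* Main.v *)
Require Import Defs.
From HB Require Import structures.
From mathcomp Require Import all_boot all_order all_algebra.
From mathcomp Require Import complex ring lra.
From mathcomp Require Import boolp classical_sets reals topology normedtype.

Set Implicit Arguments.
Unset Strict Implicit.
Unset Printing Implicit Defensive.

Import Order.TTheory GRing.Theory Num.Theory.
Import numFieldNormedType.Exports.

Local Open Scope ring_scope.

(** Write the closed loop shifted by eps as
      Ac = A + B2 K + eps I = F - r b beta^T P,
    where b = B2 (C1 B2)^-1, beta = b - r^-1 B1, r = 2 C1 B1 is the scalar Rm,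
    and F is the matrix whose Schur form is Af.  The difference of the two
    Lyapunov equations, multiplied on both sides by (T - S)^-1, is the Riccati
    equation for Pf ([riccati_block]).  Carried back by U and combined with
    b = beta + r^-1 B1, it collapses to
      P Ac + Ac^T P = - r P b b^T P            ([lyapunov_of_riccati])
    and, since C1 F = 0 and C1 b = 1, the output satisfies
      C1 Ac = B1^T P - r b^T P.
    These two identities carry the rest of the proof.

    Stability.  Let x be an eigenvector of Ac.  If P x != 0, then x^* P x > 0
    and the Lyapunov identity makes the real part of the eigenvalue nonpositive.
    If P x = 0, then Ac x = F x and x lies in the span of the first n1 columns
    of U, where F acts as A11, whose spectrum lies in the closed left half plane
    ([closed_loop_spectrum]).  Hence the eigenvalues of A + B2 K have real part
    at most - eps, and the transfer function has no pole in the closed right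
    half plane.

    Negative imaginariness.  Only the condition on the imaginary axis is left.
    For w > 0 put x = (i w - A - B2 K)^-1 B1, so that
    C1 x = G(i w) and (eps + i w) x = Ac x + B1.  The two identities give,
    with x2 = Im x and y = b^T P x = y1 + i y2,
      w (eps^2 + w^2) Im G(i w) = - 2 eps (eps^2 + w^2) x2^T P x2
        - r/2 (w^2 y2^2 + eps^2 y2^2 + (eps y2 - w (y1 - 1))^2),
    which is nonpositive ([harmonic_response_Im_le0]).  P is singular when
    n1 > 0, so the identity must avoid its inverse.  At w = 0 the value G(0)
    is real.

    The definitions of poles and values go through a coprime representative of
    each entry; [not_pole_transfer_function] and [mxeval_transfer_function]
    translate them into eigenvalues of the state matrix and the resolvent. *)

(** * Poles and values of a transfer function *)

Section RationalValues.
Variable R : realType.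
Local Notation toC := (real_complex R).

Lemma ratfun_numden (g : ratfun R) :
  let r : {ratio {poly R}} := repr g in g * tofrac \d_r = tofrac \n_r.
Proof.
rewrite /= -{1}[g]reprK; set r := repr g.
unlock FracField.tofrac; rewrite -[LHS]FracField.pi_mul.
apply/eqmodP; rewrite /= FracField.equivfE /FracField.mulf /=.
by rewrite !numden_Ratio ?mulr1 ?oner_eq0 ?denom_ratioP // mulrC.
Qed.

Lemma coprimep_ratnum_ratden (g : ratfun R) : coprimep (ratnum g) (ratden g).
Proof. by apply: coprimep_div_gcd; rewrite denom_ratioP orbT. Qed.

(** Any way of writing [g] as a fraction, reduced or not, is compared with
    [ratnum g] and [ratden g] by cross multiplication. *)
Lemma ratnum_cross (p q : {poly R}) (g : ratfun R) :
  g * tofrac q = tofrac p -> ratnum g * q = p * ratden g.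
Proof.
rewrite /ratnum /ratden; have /= := ratfun_numden g.
set r : {ratio {poly R}} := repr g => gE gq.
have d0 := denom_ratioP r.
have cross : \n_r * q = p * \d_r.
  apply/eqP; rewrite -tofrac_eq !tofracM -gE -gq; apply/eqP; ring.
have gcd0 : gcdp \n_r \d_r != 0 by rewrite gcdp_eq0 negb_and d0 orbT.
apply: (mulIf gcd0); rewrite mulrAC divpK ?dvdp_gcdl // -mulrA.
by rewrite divpK ?dvdp_gcdr.
Qed.

Lemma ratden_dvd (p q : {poly R}) (g : ratfun R) :
  g * tofrac q = tofrac p -> ratden g %| q.
Proof.
move=> /ratnum_cross e.
rewrite -(Gauss_dvdpr _ (_ : coprimep _ (ratnum g))) ?e ?dvdp_mull //.
by rewrite coprimep_sym coprimep_ratnum_ratden.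
Qed.

(** The denominator [q] may be unreduced: [ratden g] divides it, hence does not
    vanish at [z] either. *)
Section AtPoint.
Variables (p q : {poly R}) (g : ratfun R) (z : R[i]).
Hypothesis gq : g * tofrac q = tofrac p.
Hypothesis qz : ~~ root (map_poly toC q) z.

Let denz : (map_poly toC (ratden g)).[z] != 0.
Proof.
apply: contra qz => /eqP den0.
rewrite /root -(divpK (ratden_dvd gq)) rmorphM /= hornerM den0 mulr0.
exact: eqxx.
Qed.

Lemma rat_pole_order_frac : rat_pole_order g z = 0%N.
Proof. by rewrite /rat_pole_order mupNroot. Qed.

Lemma rateval_frac : rateval g z = (map_poly toC p).[z] / (map_poly toC q).[z].
Proof.
have qz0 : (map_poly toC q).[z] != 0 := qz.
rewrite /rateval; apply/eqP; rewrite eqr_div // -!hornerM -!rmorphM /=.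
by rewrite (ratnum_cross gq).
Qed.
End AtPoint.

Section TransferFunction.
Variables (n m p : nat) (A : 'M[R]_n) (B : 'M[R]_(n, m)) (C : 'M[R]_(p, n)).
Variable (D : 'M[R]_(p, m)).
Local Notation G := (transfer_function A B C D).

(** Cramer's rule over the field of rational functions: the characteristic
    polynomial is a common denominator of the entries. *)
Lemma transfer_function_frac i k :
  G i k * tofrac (char_poly A) =
  tofrac ((map_mx polyC C *m \adj (char_poly_mx A) *m map_mx polyC B
           + char_poly A *: map_mx polyC D) i k).
Proof.
pose tf : {rmorphism {poly R} -> ratfun R} := @tofrac {poly R}.
have toFE k1 k2 (M : 'M[R]_(k1, k2)) :
  map_mx (fun a : R => tofrac a%:P) M = map_mx tf (map_mx polyC M).
  by rewrite -map_mx_comp.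
have sIA : (tf 'X)%:M - map_mx (fun a : R => tofrac a%:P) A =
           map_mx tf (char_poly_mx A).
  by rewrite toFE -map_scalar_mx -map_mxB.
have det0 : tf (char_poly A) != 0.
  by rewrite tofrac_eq0 monic_neq0 // char_poly_monic.
have detE : \det (map_mx tf (char_poly_mx A)) = tf (char_poly A).
  by rewrite det_map_mx.
rewrite /transfer_function sIA !toFE /invmx unitmxE detE unitfE det0.
rewrite -map_mx_adj -scalemxAr -scalemxAl -!map_mxM !mxE mulrDl.
rewrite tofracD tofracM (mulrC (tf (char_poly A))); congr (_ + _).
by rewrite mulrAC mulVf // mul1r.
Qed.

Variable z : R[i].
Hypothesis Az : ~ ceigenvalue A z.

Lemma ceigenvalueE :
  eigenvalue (map_mx toC A) z = root (map_poly toC (char_poly A)) z.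
Proof. by rewrite eigenvalue_root_char map_char_poly. Qed.

Let chiz : ~~ root (map_poly toC (char_poly A)) z.
Proof. by rewrite -ceigenvalueE; apply/negP. Qed.

Lemma not_pole_transfer_function : ~ is_pole G z.
Proof.
rewrite /is_pole /pole_order big1 // => i _; rewrite big1 // => k _.
exact: rat_pole_order_frac (transfer_function_frac i k) chiz.
Qed.

Lemma unitmx_resolvent : z%:M - map_mx toC A \in unitmx.
Proof.
rewrite unitmxE unitfE; apply: contra chiz => /det0P [v v0 vA].
rewrite -ceigenvalueE; apply/eigenvalueP; exists v => //.
by move: vA; rewrite mulmxBr mul_mx_scalar => /eqP; rewrite subr_eq0 => /eqP.
Qed.

Lemma mxeval_transfer_function :
  mxeval G z = map_mx toC C *m invmx (z%:M - map_mx toC A) *m map_mx toC B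
               + map_mx toC D.
Proof.
(* Evaluation at z as a ring morphism, so that it commutes with the adjugate
   and the determinant. *)
pose evM : {rmorphism {poly R} -> R[i]} := horner_eval z \o map_poly toC.
have evC k1 k2 (M : 'M[R]_(k1, k2)) :
    map_mx evM (map_mx polyC M) = map_mx toC M.
  by apply/matrixP => i j; rewrite !mxE /= map_polyC /horner_eval /= hornerC.
have sIA : map_mx evM (char_poly_mx A) = z%:M - map_mx toC A.
  rewrite /char_poly_mx map_mxB evC map_scalar_mx /= map_polyX.
  by rewrite /horner_eval hornerX.
have detE : \det (z%:M - map_mx toC A) = evM (char_poly A).
  by rewrite -sIA det_map_mx.
apply/matrixP => i k; rewrite mxE.
rewrite (rateval_frac (transfer_function_frac i k) chiz).
rewrite -[(map_poly _ _).[z]]/(evM _) -[(map_poly _ (char_poly A)).[z]]/(evM _).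
have /eqP := chiz.
rewrite -[(map_poly _ (char_poly A)).[z]]/(evM _) => chi0.
rewrite /invmx unitmx_resolvent detE -sIA -map_mx_adj -!evC.
rewrite -scalemxAr -scalemxAl -!map_mxM [RHS]mxE.
rewrite mxE rmorphD mulrDl; congr (_ + _); rewrite !mxE.
  by rewrite mulrC.
by rewrite rmorphM mulrAC divff ?mul1r //; apply/eqP.
Qed.
End TransferFunction.
End RationalValues.

(** * Real and imaginary parts of complex columns *)

Section ComplexColumns.
Variable R : realType.
Local Notation toC := (real_complex R).
Local Notation Remx := (map_mx (@complex.Re R)).
Local Notation Immx := (map_mx (@complex.Im R)).

Lemma Re_mulmx m n k (M : 'M[R]_(m, n)) (Z : 'M[R[i]]_(n, k)) :
  Remx (map_mx toC M *m Z) = M *m Remx Z.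
Proof.
apply/matrixP => i j; rewrite !mxE.
rewrite (big_morph _ (raddfD (@complex.Re R : Rcomplex R -> R)) (erefl _)).
by apply: eq_bigr => l _; rewrite !mxE; case: (Z l j) => a b /=; ring.
Qed.

Lemma Im_mulmx m n k (M : 'M[R]_(m, n)) (Z : 'M[R[i]]_(n, k)) :
  Immx (map_mx toC M *m Z) = M *m Immx Z.
Proof.
apply/matrixP => i j; rewrite !mxE.
rewrite (big_morph _ (raddfD (@complex.Im R : Rcomplex R -> R)) (erefl _)).
by apply: eq_bigr => l _; rewrite !mxE; case: (Z l j) => a b /=; ring.
Qed.

Lemma ReIm_mx_inj m n (Y Z : 'M[R[i]]_(m, n)) :
  Remx Y = Remx Z -> Immx Y = Immx Z -> Y = Z.
Proof.
move=> /matrixP re /matrixP im; apply/matrixP => i j.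
have := re i j; have := im i j; rewrite !mxE => imE reE.
by apply/eqP; rewrite eq_complex reE imE !eqxx.
Qed.

Lemma Re_scalemx m n (z : R[i]) (Z : 'M[R[i]]_(m, n)) :
  Remx (z *: Z) = complex.Re z *: Remx Z - complex.Im z *: Immx Z.
Proof. by apply/matrixP => i j; rewrite !mxE; case: z (Z i j) => ? ? []. Qed.

Lemma Im_scalemx m n (z : R[i]) (Z : 'M[R[i]]_(m, n)) :
  Immx (z *: Z) = complex.Re z *: Immx Z + complex.Im z *: Remx Z.
Proof.
by apply/matrixP => i j; rewrite !mxE; case: z (Z i j) => ? ? [? ?] /=; ring.
Qed.

(** The column [u + i v] is an eigenvector of [M] for [z], in real terms. *)
Definition eigencolumns n (M : 'M[R]_n) (z : R[i]) (u v : 'cV[R]_n) :=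
  [/\ (u != 0) || (v != 0),
      M *m u = complex.Re z *: u - complex.Im z *: v
    & M *m v = complex.Re z *: v + complex.Im z *: u].

Lemma eigenvalue_tr (F : fieldType) n (M : 'M[F]_n) :
  eigenvalue M^T =1 eigenvalue M.
Proof.
move=> a; rewrite !eigenvalue_root_char; congr (root _ a).
rewrite /char_poly -det_tr /char_poly_mx linearB /= tr_scalar_mx.
by rewrite map_trmx trmxK.
Qed.

(** Eigenvectors in the sense of [eigenvalue] are rows; transposing the matrix,
    which keeps the spectrum, yields columns. *)
Lemma ceigenvalueP n (M : 'M[R]_n) (z : R[i]) :
  ceigenvalue M z <-> exists u v, eigencolumns M z u v.
Proof.
rewrite /ceigenvalue -eigenvalue_tr; split.
  move=> /eigenvalueP [w wM w0]; set x := w^T.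
  have Mx : map_mx toC M *m x = z *: x.
    by rewrite -[map_mx toC M]trmxK -trmx_mul wM linearZ.
  exists (Remx x), (Immx x); split.
  - rewrite -negb_and; apply: contra w0 => /andP [/eqP re /eqP im].
    rewrite -[w]trmxK -/x -trmx0; apply/eqP; congr trmx.
    by apply: ReIm_mx_inj; rewrite ?re ?im; apply/matrixP => i j; rewrite !mxE.
  - by rewrite -Re_mulmx Mx Re_scalemx.
  - by rewrite -Im_mulmx Mx Im_scalemx.
move=> [u [v [uv0 Mu Mv]]].
pose x : 'cV[R[i]]_n := \col_k (u k 0 +i* v k 0)%C.
have xu : Remx x = u by apply/matrixP => i j; rewrite !mxE ord1.
have xv : Immx x = v by apply/matrixP => i j; rewrite !mxE ord1.
have Mx : map_mx toC M *m x = z *: x.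
  by apply: ReIm_mx_inj;
    rewrite ?Re_mulmx ?Im_mulmx ?Re_scalemx ?Im_scalemx xu xv.
apply/eigenvalueP; exists x^T; first by rewrite -trmx_mul Mx linearZ.
apply: contraTneq uv0 => /(congr1 trmx); rewrite trmxK trmx0 => x0.
rewrite -negb_and negbK -xu -xv x0.
by apply/andP; split; apply/eqP/matrixP => i j; rewrite !mxE.
Qed.
End ComplexColumns.

(** * Consequences of the Lyapunov identity *)

Section Lyapunov.
Variable R : realType.

(** Traces of 1 x 1 matrices stand for scalars because the trace is linear. *)
Section Form.
Variables (n : nat) (P Ac : 'M[R]_n) (b : 'cV[R]_n) (r : R).
Local Notation form x y := (\tr (x^T *m P *m y)).
Local Notation out x := (\tr (b^T *m P *m x)).
Hypothesis Psym : P^T = P.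
Hypothesis lyap : P *m Ac + Ac^T *m P = - (r *: (P *m b *m b^T *m P)).

Lemma formC (x y : 'cV[R]_n) : form x y = form y x.
Proof. by rewrite -[LHS]mxtrace_tr !trmx_mul trmxK Psym mulmxA. Qed.

Lemma form_lyapunov (x y : 'cV[R]_n) :
  form x (Ac *m y) + form y (Ac *m x) = - (r * (out x * out y)).
Proof.
have -> : form y (Ac *m x) = \tr (x^T *m (Ac^T *m P) *m y).
  by rewrite -[LHS]mxtrace_tr !trmx_mul trmxK Psym !mulmxA.
have -> : form x (Ac *m y) = \tr (x^T *m (P *m Ac) *m y) by rewrite !mulmxA.
rewrite -mxtraceD -mulmxDl -mulmxDr lyap mulmxN mulNmx raddfN /=.
rewrite -scalemxAr -scalemxAl mxtraceZ; congr (- (_ * _)).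
have -> : x^T *m (P *m b *m b^T *m P) *m y =
          (b^T *m P *m x)^T *m (b^T *m P *m y).
  by rewrite !trmx_mul !trmxK Psym !mulmxA.
by rewrite !trace_mx11 mxE big_ord1 mxE.
Qed.

(** For an eigenvector x = u + i v, the identity reads
    2 Re z (x^* P x) = - r |b^T P x|^2. *)
Lemma lyapunov_Re_le0 (z : R[i]) (u v : 'cV[R]_n) :
  0 <= r -> eigencolumns Ac z u v -> 0 < form u u + form v v ->
  complex.Re z <= 0.
Proof.
move=> r0 [_ Au Av] pos.
have := form_lyapunov u u; have := form_lyapunov v v.
rewrite Au Av !mulmxDr mulmxN -!scalemxAr !mxtraceD raddfN /= !mxtraceZ.
rewrite (formC v u).
move=> hv hu; rewrite -(pmulr_lle0 _ pos).
have := mulr_ge0 r0 (sqr_ge0 (out u)); have := mulr_ge0 r0 (sqr_ge0 (out v)).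
lra.
Qed.

Variables (B : 'cV[R]_n) (C : 'rV[R]_n).
Hypothesis CAc : C *m Ac = B^T *m P - r *: (b^T *m P).
Hypothesis CB : \tr (C *m B) = r / 2.

(** Here x1 + i x2 is the state of the shifted system at the complex frequency
    s = eps + i w.  The first component of the output is eliminated between the
    two equations for C Ac x1 and C Ac x2; the polarized Lyapunov identity then
    expresses the forms of x1 and x2 with B through those among x1 and x2, and
    its instance at (x2, x2) expresses the form of x1 and x2 through that of x2.
    The remaining terms are a sum of squares. *)
Lemma harmonic_response_Im_le0 (eps w : R) (x1 x2 : 'cV[R]_n) :
  0 <= r -> 0 < eps -> 0 < w -> 0 <= form x2 x2 ->
  Ac *m x1 + B = eps *: x1 - w *: x2 -> Ac *m x2 = eps *: x2 + w *: x1 ->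
  \tr (C *m x2) <= 0.
Proof.
move=> r0 e0 w0 X22 Ax1 Ax2.
have {}Ax1 : Ac *m x1 = eps *: x1 - w *: x2 - B by rewrite -Ax1 addrK.
have outC x : \tr (C *m (Ac *m x)) = form x B - r * out x.
  rewrite mulmxA CAc mulmxBl -scalemxAl raddfB /= mxtraceZ; congr (_ - _).
  by rewrite -[LHS]mxtrace_tr !trmx_mul trmxK Psym mulmxA.
have c1 := outC x1; have c2 := outC x2.
have l11 := form_lyapunov x1 x1; have l12 := form_lyapunov x1 x2.
have l22 := form_lyapunov x2 x2.
move: c1 c2 l11 l12 l22; rewrite Ax1 Ax2 (mulmxDr, mulmxN) !(mulmxDr, mulmxN).
rewrite -!scalemxAr !(mxtraceD, raddfN) /= !mxtraceZ CB (formC x2 x1).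
move: (form x1 x1) (form x1 x2) (form x2 x2) X22 (out x1) (out x2).
move: (form x1 B) (form x2 B) (\tr (C *m x1)) (\tr (C *m x2)).
move=> b1 b2 g1 g2 X11 X12 X22 X22_ge0 y1 y2 c1 c2 l11 l12 l22.
have key : w * (eps ^+ 2 + w ^+ 2) * g2 =
    - (2 * eps * (eps ^+ 2 + w ^+ 2) * X22)
    - r / 2 * (w ^+ 2 * y2 ^+ 2 + eps ^+ 2 * y2 ^+ 2
               + (eps * y2 - w * (y1 - 1)) ^+ 2).
  (* The multipliers that eliminate g1, b1, b2, X11 and X12. *)
  have /= := congr1 (fun t => w * eps * t) c2.
  have /= := congr1 (fun t => w ^+ 2 * t) c1.
  have /= := congr1 (fun t => w * eps * t) l12.
  have /= := congr1 (fun t => w ^+ 2 / 2 * t) l11.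
  have /= := congr1 (fun t => (eps ^+ 2 + w ^+ 2 / 2) * t) l22.
  lra.
have s0 : 0 < w * (eps ^+ 2 + w ^+ 2).
  by rewrite mulr_gt0 // addr_gt0 // exprn_gt0.
rewrite -(pmulr_rle0 _ s0) key -opprD oppr_le0.
have r2 : 0 <= r / 2 by rewrite divr_ge0.
have s2 : 0 <= eps ^+ 2 + w ^+ 2 by rewrite addr_ge0 ?sqr_ge0.
have := mulr_ge0 (mulr_ge0 (ltW e0) s2) X22_ge0.
have := mulr_ge0 r2 (sqr_ge0 (w * y2)).
have := mulr_ge0 r2 (sqr_ge0 (eps * y2)).
have := mulr_ge0 r2 (sqr_ge0 (eps * y2 - w * (y1 - 1))).
lra.
Qed.
End Form.
End Lyapunov.

(** * The negative imaginary property *)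

Section NegativeImaginary.
Variable R : realType.
Local Notation toC := (real_complex R).
Local Notation Remx := (map_mx (@complex.Re R)).
Local Notation Immx := (map_mx (@complex.Im R)).

(** For a scalar g, i times the difference of g and its conjugate is
    - 2 Im g. *)
Lemma hpsdmx_11 (g : 'M[R[i]]_1) :
  complex.Im (g 0 0) <= 0 -> hpsdmx ('i%C *: (g - (g ^t*)%sesqui)).
Proof.
case gE : (g 0 0) => [a b] /= b0; set M := (X in hpsdmx X).
have ME : M = (- (2 * b))%:C%C%:M.
  apply/matrixP => i k; rewrite !ord1 /M !mxE gE mulr1n.
  by apply/eqP; rewrite eq_complex /=; apply/andP; split; apply/eqP; ring.
have h0 : 0 <= (- (2 * b))%:C%C :> R[i] by rewrite lecE /= eqxx /=; lra.
rewrite ME; split => [|x].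
  by apply/matrixP => i k; rewrite !ord1 !mxE /= mulr1n; apply: conj_Creal;
     apply: ger0_real.
rewrite mul_mx_scalar -scalemxAl mxE mulr_ge0 // mxE sumr_ge0 // => i _.
by rewrite !mxE mulrC mul_conjC_ge0.
Qed.

(** The degree of stability puts every pole in the open left half plane, so the
    conditions on poles hold vacuously and only the imaginary axis matters. *)
Lemma shifted_lyapunov_negative_imaginary n (A P : 'M[R]_n) (b B : 'cV[R]_n)
    (C : 'rV[R]_n) (r eps : R) :
  let Ac := A + eps%:M in
  P^T = P -> (forall x : 'cV[R]_n, 0 <= \tr (x^T *m P *m x)) ->
  0 <= r -> 0 < eps ->
  P *m Ac + Ac^T *m P = - (r *: (P *m b *m b^T *m P)) ->
  C *m Ac = B^T *m P - r *: (b^T *m P) ->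
  \tr (C *m B) = r / 2 ->
  degree_of_stability A eps ->
  negative_imaginary (transfer_function A B C 0).
Proof.
move=> Ac Psym Ppos r0 e0 lyap CAc CB stab.
have noeig (z : R[i]) : 0 <= complex.Re z -> ~ ceigenvalue A z.
  by move=> z0 /stab; lra.
have nopole (z : R[i]) : 0 <= complex.Re z ->
    ~ is_pole (transfer_function A B C 0) z.
  by move=> /noeig; apply: not_pole_transfer_function.
split.
- by move=> z /ltW; apply: nopole.
- move=> w w0 _; apply: hpsdmx_11.
  have nz := noeig (w*i)%C (lexx 0).
  rewrite (mxeval_transfer_function _ _ _ nz) map_mx0 addr0.
  rewrite -mulmxA; set z := (w*i)%C; set x := invmx _ *m map_mx toC B.
  have xE : map_mx toC A *m x + map_mx toC B = z *: x.
    rewrite -[map_mx toC B](mulKVmx (unitmx_resolvent nz)) -/x.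
    by rewrite mulmxBl mul_scalar_mx addrC subrK.
  have BRe : Remx (map_mx toC B) = B by apply/matrixP => i k; rewrite !mxE.
  have BIm : Immx (map_mx toC B) = 0 by apply/matrixP => i k; rewrite !mxE.
  have ReD (Y Z : 'cV[R[i]]_n) : Remx (Y + Z) = Remx Y + Remx Z.
    by apply/matrixP => i k; rewrite !mxE; case: (Y i k) (Z i k) => ? ? [].
  have ImD (Y Z : 'cV[R[i]]_n) : Immx (Y + Z) = Immx Y + Immx Z.
    by apply/matrixP => i k; rewrite !mxE; case: (Y i k) (Z i k) => ? ? [].
  have Ax1 : A *m Remx x + B = - (w *: Immx x).
    by rewrite -[X in _ + X]BRe -Re_mulmx -ReD xE Re_scalemx scale0r add0r.
  have Ax2 : A *m Immx x = w *: Remx x.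
    by rewrite -[LHS]addr0 -BIm -Im_mulmx -ImD xE Im_scalemx scale0r add0r.
  have -> : complex.Im ((map_mx toC C *m x) 0 0) = \tr (C *m Immx x).
    by rewrite trace_mx11 -Im_mulmx [RHS]mxE.
  have [wpos|] := ltrP 0 w.
    apply: (harmonic_response_Im_le0 Psym lyap CAc CB (x1 := Remx x)
              r0 e0 wpos) => //.
      by rewrite mulmxDl mul_scalar_mx addrAC Ax1 addrC.
    by rewrite mulmxDl mul_scalar_mx Ax2 addrC.
  (* At w = 0 a nonzero Im x would be an eigenvector of A for 0. *)
  move=> wneg; have {wneg} w00 : w = 0 by apply/eqP; rewrite eq_le w0 wneg.
  have [->|x2] := eqVneq (Immx x) 0; first by rewrite mulmx0 mxtrace0.
  case: (noeig 0 (lexx 0)); apply/ceigenvalueP; exists (Immx x), 0; split.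
  + by rewrite x2.
  + by rewrite Ax2 w00 !scale0r subr0.
  + by rewrite mulmx0 scaler0 scale0r addr0.
- by move=> w w0 /nopole; case.
- by move=> /nopole; case.
Qed.
End NegativeImaginary.

(** * The Riccati equation *)

Section Riccati.
Variable R : realType.

Lemma pdmx_unit n (H : 'M[R]_n) : pdmx H -> H \in unitmx.
Proof.
move=> [_ Hpos]; rewrite unitmxE unitfE; apply/negP => /det0P [v v0 vH].
have := Hpos v^T; rewrite trmxK vH mul0mx mxE ltxx.
have -> : v^T != 0 by apply: contra v0 => /eqP e; rewrite -[v]trmxK e trmx0.
by move=> /(_ isT).
Qed.

Lemma pdmx_inv n (H : 'M[R]_n) : pdmx H -> pdmx (invmx H).
Proof.
move=> Hpd; have Hu := pdmx_unit Hpd; case: (Hpd) => Hsym Hpos.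
have Xsym : (invmx H)^T = invmx H by rewrite trmx_inv Hsym.
split=> // x x0.
have -> : x^T *m invmx H *m x = (invmx H *m x)^T *m H *m (invmx H *m x).
  by rewrite trmx_mul Xsym -!mulmxA (mulKVmx Hu).
apply: Hpos; apply: contra x0 => /eqP e.
by rewrite -(mulKVmx Hu x) e mulmx0.
Qed.

Section Block.
Variables (n1 n2 k : nat).
Variables (A11 : 'M[R]_n1) (A12 : 'M[R]_(n1, n2)) (A22 : 'M[R]_n2).
Variables (Bf1 B11 : 'M[R]_(n1, k)) (Bf2 B22 : 'M[R]_(n2, k)).
Variables (Rm : 'M[R]_k) (T S : 'M[R]_n2).
Local Notation Af := (block_mx A11 A12 0 A22).
Local Notation Bf := (col_mx Bf1 Bf2).
Local Notation B1t := (col_mx B11 B22).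
Local Notation X := (invmx (T - S)).
Local Notation Pf := (block_mx (0 : 'M[R]_n1) 0 0 X).

(** With H = T - S and X its inverse, X A22 + A22^T X = X (A22 H + H A22^T) X,
    and A22 H + H A22^T is the difference of the two Lyapunov equations.  The
    other blocks vanish because Af is block upper triangular. *)
Lemma riccati_block :
  T - S \in unitmx ->
  - (A22 *m T) - T *m A22^T + Bf2 *m Rm *m Bf2^T = 0 ->
  - (A22 *m S) - S *m A22^T + B22 *m invmx Rm *m B22^T = 0 ->
  Pf *m Af + Af^T *m Pf - Pf *m Bf *m Rm *m Bf^T *m Pf
      + Pf *m B1t *m invmx Rm *m B1t^T *m Pf = 0.
Proof.
set H := T - S => Hu eqT eqS.
have Bf2E : Bf2 *m Rm *m Bf2^T = A22 *m T + T *m A22^T.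
  by apply/eqP; rewrite -subr_eq0 addrC opprD eqT.
have B22E : B22 *m invmx Rm *m B22^T = A22 *m S + S *m A22^T.
  by apply/eqP; rewrite -subr_eq0 addrC opprD eqS.
have XH : X *m H = 1%:M by rewrite mulVmx.
have HX : H *m X = 1%:M by rewrite mulmxV.
have low : X *m A22 + A22^T *m X - X *m (Bf2 *m Rm *m Bf2^T) *m X
           + X *m (B22 *m invmx Rm *m B22^T) *m X = 0.
  have -> : X *m A22 + A22^T *m X = X *m (A22 *m H + H *m A22^T) *m X.
    by rewrite mulmxDr mulmxDl !mulmxA XH mul1mx -!mulmxA HX mulmx1.
  have -> : A22 *m H + H *m A22^T =
            Bf2 *m Rm *m Bf2^T - B22 *m invmx Rm *m B22^T.
    by rewrite Bf2E B22E /H mulmxBr mulmxBl opprD addrACA.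
  by rewrite mulmxBr mulmxBl [_ - _ - _]addrAC subrr add0r addNr.
have sandwich (B1 : 'M[R]_(n1, k)) (B2 : 'M[R]_(n2, k)) (M : 'M[R]_k) :
    Pf *m col_mx B1 B2 *m M *m (col_mx B1 B2)^T *m Pf =
    block_mx 0 0 0 (X *m (B2 *m M *m B2^T) *m X).
  rewrite mul_block_col !mul0mx !add0r mul_col_mx mul0mx tr_col_mx mul_col_row.
  by rewrite !mul0mx mulmx_block !mulmx0 !mul0mx !add0r !mulmxA.
rewrite !sandwich tr_block_mx !trmx0 !mulmx_block !mulmx0 !mul0mx !addr0 !add0r.
by rewrite opp_block_mx !add_block_mx low !oppr0 !addr0 block_mx0.
Qed.
End Block.

(** The orthogonal change of coordinates from the Schur basis back to the
    original one. *)
Lemma riccati_conj n k (U Pf F : 'M[R]_n) (beta B : 'M[R]_(n, k))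
    (M N : 'M[R]_k) :
  U *m U^T = 1%:M ->
  Pf *m (U^T *m F *m U) + (U^T *m F *m U)^T *m Pf
    - Pf *m (U^T *m beta) *m M *m (U^T *m beta)^T *m Pf
    + Pf *m (U^T *m B) *m N *m (U^T *m B)^T *m Pf = 0 ->
  let P := U *m Pf *m U^T in
  P *m F + F^T *m P - P *m beta *m M *m beta^T *m P
    + P *m B *m N *m B^T *m P = 0.
Proof.
move=> UUt /(congr1 (fun Z => U *m Z *m U^T)); rewrite mulmx0 mul0mx => <- /=.
have UK l (Z : 'M[R]_(n, l)) : U *m (U^T *m Z) = Z by rewrite mulmxA UUt mul1mx.
rewrite !(mulmxDr, mulmxDl, mulmxN, mulNmx) !trmx_mul !trmxK -!mulmxA.
by rewrite !UK UUt mulmx1.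
Qed.

(** The feedback contributes - r P (b beta^T + beta b^T) P.  Since
    beta = b - r^-1 B, this completes the square: every term in beta and B
    cancels and - r P b b^T P is left.  The matrices involved have rank one, so
    the identity is checked on entries, where multiplication is commutative. *)
Lemma lyapunov_of_riccati n (P F : 'M[R]_n) (beta B : 'cV[R]_n) (r : R) :
  let b := beta + r^-1 *: B in let Ac := F - r *: (b *m beta^T *m P) in
  r != 0 -> P^T = P ->
  P *m F + F^T *m P - P *m beta *m r%:M *m beta^T *m P
    + P *m B *m r^-1%:M *m B^T *m P = 0 ->
  P *m Ac + Ac^T *m P = - (r *: (P *m b *m b^T *m P)).
Proof.
move=> b Ac r0 Psym; rewrite !mul_mx_scalar -!scalemxAl => /matrixP ric.
have rank1 (u v : 'cV[R]_n) i j :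
    (P *m u *m v^T *m P) i j = (P *m u) i 0 * (P *m v) j 0.
  by rewrite -mulmxA -{2}Psym -trmx_mul mxE big_ord1 [X in _ * X]mxE.
have mxD (Y Z : 'M[R]_n) i j : (Y + Z) i j = Y i j + Z i j by rewrite mxE.
have mxN (Y : 'M[R]_n) i j : (- Y) i j = - Y i j by rewrite mxE.
have mxZ a (Y : 'M[R]_n) i j : (a *: Y) i j = a * Y i j by rewrite mxE.
have mxT (Y : 'M[R]_n) i j : Y^T i j = Y j i by rewrite mxE.
have PAc : P *m Ac = P *m F - r *: (P *m b *m beta^T *m P).
  by rewrite mulmxBr -scalemxAr !mulmxA.
have AcP : Ac^T *m P = (P *m Ac)^T by rewrite trmx_mul Psym.
have FP : F^T *m P = (P *m F)^T by rewrite trmx_mul Psym.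
have Pb i : (P *m b) i 0 = (P *m beta) i 0 + r^-1 * (P *m B) i 0.
  by rewrite mulmxDr -scalemxAr mxE [X in _ + X]mxE.
have {}ric i j : (P *m F) i j + (P *m F) j i
    - r * ((P *m beta) i 0 * (P *m beta) j 0)
    + r^-1 * ((P *m B) i 0 * (P *m B) j 0) = 0.
  by have := ric i j; rewrite FP !(mxD, mxN, mxZ) mxT !rank1 => ->; rewrite mxE.
apply/matrixP => i j; rewrite AcP PAc.
rewrite !(mxD, mxN, mxZ, mxT) !rank1 !Pb.
have := ric i j.
move: ((P *m F) i j) ((P *m F) j i) => f1 f2 e.
have {e} -> : f1 = - f2 + r * ((P *m beta) i 0 * (P *m beta) j 0)
    - r^-1 * ((P *m B) i 0 * (P *m B) j 0) by lra.
by field.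
Qed.
End Riccati.

(** * The spectrum of the closed loop *)

Section ClosedLoop.
Variables (R : realType) (n1 n2 : nat).
Variables (U : 'M[R]_(n1 + n2)) (X : 'M[R]_n2).
Local Notation P := (U *m block_mx (0 : 'M[R]_n1) 0 0 X *m U^T).
Local Notation low u := (dsubmx (U^T *m u)).

Lemma mulmx_low (u : 'cV[R]_(n1 + n2)) : P *m u = U *m col_mx 0 (X *m low u).
Proof.
rewrite -!mulmxA -[in LHS](vsubmxK (U^T *m u)) mul_block_col.
by rewrite !mul0mx !add0r.
Qed.

Lemma form_low (u : 'cV[R]_(n1 + n2)) :
  \tr (u^T *m P *m u) = \tr ((low u)^T *m X *m low u).
Proof.
rewrite -mulmxA mulmx_low mulmxA -{1}[U]trmxK -trmx_mul.
by rewrite -{1}(vsubmxK (U^T *m u)) tr_col_mx mul_row_col mulmx0 add0r mulmxA.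
Qed.

Hypothesis Xpd : pdmx X.

Lemma form_ge0 (u : 'cV[R]_(n1 + n2)) : 0 <= \tr (u^T *m P *m u).
Proof.
rewrite form_low trace_mx11; have [->|/(proj2 Xpd)/ltW //] := eqVneq (low u) 0.
by rewrite mulmx0 mxE.
Qed.

Lemma form_gt0 (u : 'cV[R]_(n1 + n2)) : low u != 0 -> 0 < \tr (u^T *m P *m u).
Proof. by rewrite form_low trace_mx11 => /(proj2 Xpd). Qed.

Variables (F : 'M[R]_(n1 + n2)) (A11 : 'M[R]_n1) (A12 : 'M[R]_(n1, n2)).
Variables (A22 : 'M[R]_n2) (b beta : 'cV[R]_(n1 + n2)) (r : R).
Hypothesis UU : U^T *m U = 1%:M.
Hypothesis FE : U^T *m F *m U = block_mx A11 A12 0 A22.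
Hypothesis A11stable : spectrum_closed_lhp A11.
Hypothesis r0 : 0 <= r.
Let Ac := F - r *: (b *m beta^T *m P).
Hypothesis lyap : P *m Ac + Ac^T *m P = - (r *: (P *m b *m b^T *m P)).

(** On the kernel of [P] the feedback vanishes and the matrix acts as [A11];
    off the kernel the Lyapunov identity bounds the real part. *)
Lemma closed_loop_spectrum : spectrum_closed_lhp Ac.
Proof.
have UUt : U *m U^T = 1%:M by apply: mulmx1C.
have Psym : P^T = P.
  by rewrite !trmx_mul trmxK tr_block_mx !trmx0 (proj1 Xpd) mulmxA.
move=> z /ceigenvalueP [u [v uv]].
have [/andP [/eqP u2 /eqP v2]|low0] := boolP ((low u == 0) && (low v == 0)).
  case: uv => uv0 Au Av; apply: A11stable.
  have AcE (x : 'cV[R]_(n1 + n2)) : low x = 0 ->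
      A11 *m usubmx (U^T *m x) = usubmx (U^T *m (Ac *m x)).
    move=> x0; rewrite /Ac mulmxBl -scalemxAl -(mulmxA (b *m _)) mulmx_low x0.
    rewrite mulmx0 col_mx0 !mulmx0 scaler0 subr0.
    rewrite -{2}[x]mul1mx -UUt -!mulmxA (mulmxA U^T F) (mulmxA _ U) FE.
    rewrite -[in RHS](vsubmxK (U^T *m x)) x0 mul_block_col col_mxKu.
    by rewrite mulmx0 addr0.
  have nz (x : 'cV[R]_(n1 + n2)) :
      low x = 0 -> x != 0 -> usubmx (U^T *m x) != 0.
    move=> x0; apply: contra => /eqP x1; rewrite -[x]mul1mx -UUt -mulmxA.
    by rewrite -(vsubmxK (U^T *m x)) x0 x1 col_mx0 mulmx0.
  apply/ceigenvalueP; exists (usubmx (U^T *m u)), (usubmx (U^T *m v)); split.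
  - by case/orP: uv0 => /nz -> //; rewrite orbT.
  - by rewrite AcE // Au mulmxBr -!scalemxAr linearB /= !linearZ.
  - by rewrite AcE // Av mulmxDr -!scalemxAr linearD /= !linearZ.
apply: (lyapunov_Re_le0 Psym lyap r0 uv).
move: low0; rewrite negb_and => /orP [] /form_gt0 pos.
  by rewrite ltr_wpDr ?form_ge0.
by rewrite ltr_wpDl ?form_ge0.
Qed.
End ClosedLoop.

(** * The closed loop is negative imaginary with degree of stability eps *)

Theorem mainTheorem3 (R : realType) (n1 n2 : nat)
    (A : 'M[R]_(n1 + n2)) (B1 B2 : 'M[R]_(n1 + n2, 1)) (C1 : 'M[R]_(1, n1 + n2))
    (eps : R) (U : 'M[R]_(n1 + n2))
    (A11 : 'M[R]_n1) (A12 : 'M[R]_(n1, n2)) (A22 : 'M[R]_n2)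
    (Bf1 B11 : 'M[R]_(n1, 1)) (Bf2 B22 : 'M[R]_(n2, 1))
    (T S : 'M[R]_n2) :
  let Rm : 'M[R]_1 := C1 *m B1 + B1^T *m C1^T in
  let Af := U^T *m (A + eps%:M - B2 *m invmx (C1 *m B2) *m C1 *m A
                    - eps *: (B2 *m invmx (C1 *m B2) *m C1)) *m U in
  let Bf := U^T *m (B2 *m invmx (C1 *m B2) - B1 *m invmx Rm) in
  let B1t := U^T *m B1 in
  C1 *m B2 \in unitmx ->
  pdmx Rm ->
  minimal_realization A B1 C1 0 (transfer_function A B1 C1 0) ->
  0 < eps ->
  U^T *m U = 1%:M ->
  Af = block_mx A11 A12 0 A22 ->
  spectrum_closed_lhp A11 ->
  antistable A22 ->
  Bf = col_mx Bf1 Bf2 ->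
  B1t = col_mx B11 B22 ->
  psdmx T ->
  psdmx S ->
  - (A22 *m T) - T *m A22^T + Bf2 *m Rm *m Bf2^T = 0 ->
  - (A22 *m S) - S *m A22^T + B22 *m invmx Rm *m B22^T = 0 ->
  pdmx (T - S) ->
  let ni_with_degree (K : 'M[R]_(1, n1 + n2)) :=
    negative_imaginary (transfer_function (A + B2 *m K) B1 C1 0) /\
    degree_of_stability (A + B2 *m K) eps in
  let Pf : 'M[R]_(n1 + n2) := block_mx 0 0 0 (invmx (T - S)) in
  let P := U *m Pf *m U^T in
  [/\ exists K : 'M[R]_(1, n1 + n2), ni_with_degree K,
      ni_with_degree (invmx (C1 *m B2) *m
        (B1^T *m P - C1 *m A - eps *: C1
         - Rm *m invmx (B2^T *m C1^T) *m B2^T *m P)),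
      psdmx Pf
    & Pf *m Af + Af^T *m Pf - Pf *m Bf *m Rm *m Bf^T *m Pf
      + Pf *m B1t *m invmx Rm *m B1t^T *m Pf = 0].

Proof.
set c := C1 *m B2; move=> Rm Af Bf B1t cu Rpd _ e0 UU AfE A11st _ BfE B1tE.
move=> _ _ eqT eqS Hpd ni Pf P.
have Xpd := pdmx_inv Hpd.
pose r := \tr Rm.
have RmE : Rm = r%:M by rewrite /r trace_mx11 -mx11_scalar.
have r0 : 0 < r.
  have := proj2 Rpd 1%:M (oner_neq0 _).
  by rewrite trmx1 mul1mx mulmx1 /r trace_mx11.
have RmV : invmx Rm = (r^-1)%:M by rewrite RmE invmx_scalar.
have UUt : U *m U^T = 1%:M by apply: mulmx1C.
have Pfpsd : psdmx Pf.
  split; first by rewrite tr_block_mx !trmx0 (proj1 Xpd).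
  move=> x; have := form_ge0 1%:M Xpd x.
  by rewrite mul1mx trmx1 mulmx1 trace_mx11.
have ric : Pf *m Af + Af^T *m Pf - Pf *m Bf *m Rm *m Bf^T *m Pf
      + Pf *m B1t *m invmx Rm *m B1t^T *m Pf = 0.
  by rewrite AfE BfE B1tE; apply: riccati_block (pdmx_unit Hpd) eqT eqS.
(* The explicit gain also witnesses the existence claim. *)
set K := invmx c *m _.
suff niK : ni K by split=> //; exists K.
have Psym : P^T = P by rewrite /P !trmx_mul trmxK (proj1 Pfpsd) mulmxA.
pose b := B2 *m invmx c; pose beta := b - r^-1 *: B1.
pose F := A + eps%:M - b *m C1 *m A - eps *: (b *m C1).
have FE : U^T *m F *m U = block_mx A11 A12 0 A22 by rewrite -AfE.
pose Ac := F - r *: (b *m beta^T *m P).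
have betaE : B2 *m invmx c - B1 *m invmx Rm = beta.
  by rewrite RmV mul_mx_scalar.
have ricP : P *m F + F^T *m P - P *m beta *m r%:M *m beta^T *m P
    + P *m B1 *m r^-1%:M *m B1^T *m P = 0.
  apply: riccati_conj UUt _; rewrite -RmE -RmV -betaE; exact: ric.
have bE : beta + r^-1 *: B1 = b by rewrite subrK.
have lyap : P *m Ac + Ac^T *m P = - (r *: (P *m b *m b^T *m P)).
  by rewrite -bE /Ac -{1 2}bE; apply: lyapunov_of_riccati => //; rewrite gt_eqF.
have betaTP : r *: (beta^T *m P) = r *: (b^T *m P) - B1^T *m P.
  rewrite [beta^T]linearB /= [(r^-1 *: B1)^T]linearZ /= mulmxBl -scalemxAl.
  by rewrite scalerBr scalerA divff ?gt_eqF // scale1r.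
have AclE : A + B2 *m K + eps%:M = Ac.
  have cT : invmx (B2^T *m C1^T) = (invmx c)^T by rewrite -trmx_mul trmx_inv.
  have B2K : B2 *m K =
      b *m (B1^T *m P) - b *m C1 *m A - eps *: (b *m C1)
      - r *: (b *m (b^T *m P)).
    rewrite /K cT RmE mul_scalar_mx -!scalemxAl -trmx_mul -/b mulmxA -/b.
    by rewrite !(mulmxDr, mulmxN) -!scalemxAr !mulmxA.
  have betaP : r *: (b *m beta^T *m P) =
      r *: (b *m (b^T *m P)) - b *m (B1^T *m P).
    by rewrite -mulmxA scalemxAr betaTP mulmxBr -scalemxAr.
  rewrite B2K /Ac betaP /F.
  move: (b *m (B1^T *m P)) (b *m C1 *m A) (b *m C1) (b *m (b^T *m P)).
  move=> Y1 Y2 Y3 Y4.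
  by move: (eps%:M) => I; apply/matrixP => i j; rewrite !mxE; ring.
have stab : degree_of_stability (A + B2 *m K) eps.
  move=> z /ceigenvalueP [u [v [uv Au Av]]].
  have : ceigenvalue Ac (z + eps%:C)%C.
    rewrite -AclE; apply/ceigenvalueP; exists u, v; split=> //.
      by rewrite mulmxDl Au mul_scalar_mx; case: z {Au Av} => x y /=;
         rewrite scalerDl addrAC addr0.
    by rewrite mulmxDl Av mul_scalar_mx; case: z {Au Av} => x y /=;
       rewrite scalerDl addrAC addr0.
  move/(closed_loop_spectrum Xpd UU FE A11st (ltW r0) lyap).
  by case: z {Au Av} => x y /=; lra.
split=> //.
apply: (shifted_lyapunov_negative_imaginary Psym (form_ge0 U Xpd) (ltW r0) e0
          (b := b)); rewrite ?AclE //.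
- have Cb : C1 *m b = 1%:M by rewrite mulmxA mulmxV.
  clearbody b.
  have CF : C1 *m F = 0.
    rewrite !(mulmxDr, mulmxN) -scalemxAr !mulmxA Cb !mul1mx mul_mx_scalar.
    by rewrite addrAC addrK subrr.
  rewrite mulmxDr CF add0r mulmxN -scalemxAr -(mulmxA b) (mulmxA C1) Cb mul1mx.
  by rewrite betaTP opprB.
- rewrite /r /Rm -trmx_mul mxtraceD mxtrace_tr.
  lra.
Qed.
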